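(* Let $\mathcal{A}\subseteq\mathcal{B}$ be sub-$\sigma$-algebras of a complete probability space $(\Omega,\mathcal{F},P)$, where $\mathcal{B}$ is generated by a countable family of events (together with the $P$-null events). Let $L$ be a linear subspace of $L_\infty(\mathcal{B})$ and $x:L\to L_\infty(\mathcal{A})$ a monotone linear operator. Assume that \[x(X)\le M(Y)\qquad\text{for all } X\in L,\ Y\in L^+_\infty(\mathcal{B}) \text{ with } X\le Y,\] for some regular, weak $\mathcal{A}$-homogeneous, sublinear operator $M:L^+_\infty(\mathcal{B})\to L^+_\infty(\mathcal{A})$. Then $x$ can be extended to a monotone linear operator $x:L_\infty(\mathcal{B})\to L_\infty(\mathcal{A})$ such that \[x(X)\le M(Y)\qquad\text{for all } X\in L_\infty(\mathcal{B}),\ Y\in L^+_\infty(\mathcal{B}) \text{ with } X\le Y.\] Furthermore, this extension is continuous from above and $\mathcal{A}$-homogeneous.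
   Context: All (in)equalities between random variables hold $P$-a.s. Sublinear: $M(X+Y)\le M(X)+M(Y)$ and $M(\lambda X)=\lambda M(X)$ for real $\lambda\ge0$. Regular: for every nonincreasing sequence $X_n\downarrow0$ $P$-a.s., $M(X_n)\to0$ $P$-a.s. Weak $\mathcal{A}$-homogeneous: $M(1_AX)=1_AM(X)$ for all $A\in\mathcal{A}$ and all $X$ in the domain. $\mathcal{A}$-homogeneous: $x(\lambda X)=\lambda x(X)$ for all $\lambda\in L^+_\infty(\mathcal{A})$. Monotone: $X\ge X'\Rightarrow x(X)\ge x(X')$. Continuous from above: for every nonincreasing sequence $X_n$ with $P$-a.s. limit $X$, $x(X_n)\downarrow x(X)$ $P$-a.s. *)

(* Defs.v *)
From HB Require Import structures.
From mathcomp Require Import all_boot all_order all_algebra.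
From mathcomp Require Import all_classical all_reals all_analysis.
Set Implicit Arguments. Unset Strict Implicit. Unset Printing Implicit Defensive.
Import Order.TTheory GRing.Theory Num.Theory numFieldNormedType.Exports.
Local Open Scope classical_set_scope.
Local Open Scope ring_scope.

Section Defs.
Context {d : measure_display} {Omega : measurableType d} {R : realType}.
Variable P : probability Omega R.

Definition sub_sigma (A : set (set Omega)) : Prop :=
  sigma_algebra setT A /\ A `<=` measurable.

Definition meas_wrt (A : set (set Omega)) (X : Omega -> R) : Prop :=
  forall B : set R, measurable B -> A (X @^-1` B).

(* representatives of elements of L_infty(A) *)
Definition Linf (A : set (set Omega)) (X : Omega -> R) : Prop :=
  meas_wrt A X /\ exists c : R, {ae P, forall w, `|X w| <= c}.

Definition Linfp (A : set (set Omega)) (X : Omega -> R) : Prop :=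
  Linf A X /\ {ae P, forall w, 0 <= X w}.

Definition aeeq (X Y : Omega -> R) : Prop := {ae P, forall w, X w = Y w}.
Definition aele (X Y : Omega -> R) : Prop := {ae P, forall w, X w <= Y w}.

Definition ctbl_gen_mod_null (B : set (set Omega)) : Prop :=
  exists G : nat -> set Omega, (forall n, measurable (G n)) /\
    B = <<s setT, range G `|` [set N | measurable N /\ P N = 0%E] >>.

Definition decr_to (Xn : nat -> Omega -> R) (X : Omega -> R) : Prop :=
  (forall n, aele (Xn n.+1) (Xn n)) /\
  {ae P, forall w, (fun n => Xn n w) @ \oo --> (X w : R^o)}.

(* M : L^+_infty(B) -> L^+_infty(A) is a well-defined operator on classes *)
Definition op_pos (A B : set (set Omega)) (M : (Omega -> R) -> (Omega -> R)) :=
  (forall X, Linfp B X -> Linfp A (M X)) /\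
  (forall X Y, Linfp B X -> Linfp B Y -> aeeq X Y -> aeeq (M X) (M Y)).

Definition sublinear (B : set (set Omega)) (M : (Omega -> R) -> (Omega -> R)) :=
  (forall X Y, Linfp B X -> Linfp B Y -> aele (M (X \+ Y)) (M X \+ M Y)) /\
  (forall (l : R) X, 0 <= l -> Linfp B X ->
      aeeq (M (fun w => l * X w)) (fun w => l * M X w)).

Definition regular (B : set (set Omega)) (M : (Omega -> R) -> (Omega -> R)) :=
  forall Xn : nat -> Omega -> R, (forall n, Linfp B (Xn n)) ->
    decr_to Xn (fun _ => 0) ->
    {ae P, forall w, (fun n => M (Xn n) w) @ \oo --> (0 : R^o)}.

Definition weak_homogeneous (A B : set (set Omega))
  (M : (Omega -> R) -> (Omega -> R)) :=
  forall (S : set Omega) X, A S -> Linfp B X ->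
    aeeq (M (fun w => (\1_S w : R) * X w)) (fun w => (\1_S w : R) * M X w).

(* L is (the set of representatives of) a linear subspace of L_infty(B) *)
Definition linear_subspace (B : set (set Omega)) (L : set (Omega -> R)) :=
  L `<=` Linf B /\ L (fun _ => 0) /\
  (forall X Y, L X -> L Y -> L (X \+ Y)) /\
  (forall (c : R) X, L X -> L (fun w => c * X w)) /\
  (forall X Y, L X -> Linf B Y -> aeeq X Y -> L Y).

Definition mono_linear_on (A : set (set Omega)) (D : set (Omega -> R))
  (x : (Omega -> R) -> (Omega -> R)) :=
  (forall X, D X -> Linf A (x X)) /\
  (forall X Y, D X -> D Y -> aeeq (x (X \+ Y)) (x X \+ x Y)) /\
  (forall (c : R) X, D X -> aeeq (x (fun w => c * X w)) (fun w => c * x X w)) /\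
  (forall X Y, D X -> D Y -> aele X Y -> aele (x X) (x Y)).

End Defs.

(* Main.v *)
(* The vector-valued extension is reduced to a scalar one. Call W in
   L_infty(A) a majorant of X if, on each piece of a countable A-measurable
   partition, X <= Y_n + Z_n and M(Y_n) + x(Z_n) <= W for some Y_n >= 0 and
   Z_n in L. Weak homogeneity makes the domination of x by M local, so
   X >= -c forces W >= -M(c), and q(X) = inf E[W] is a finite sublinear
   functional. By Hahn-Banach there is a linear phi <= q on L_infty(B); it
   satisfies phi(1_S X) <= E[1_S M(Y)] for S in A and X <= Y, and
   phi(1_S X) = E[1_S x(X)] for X in L. Hence S |-> phi(1_S X) is a charge on
   A bounded by a multiple of P, and its Radon-Nikodym density is the
   extension at X. Regularity enters only in the continuity from above,
   through 0 <= x(X_n - X) <= M(X_n - X). *)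

Require Import Defs.
From HB Require Import structures.
From mathcomp Require Import all_boot all_order all_algebra.
From mathcomp Require Import all_classical all_reals all_analysis.
From mathcomp Require Import measurable_realfun lra.
Import Order.TTheory GRing.Theory Num.Theory numFieldNormedType.Exports.
Local Open Scope classical_set_scope.
Local Open Scope ring_scope.

(** * Hahn-Banach through minimal sublinear functionals *)

Section HahnBanach.
Set Implicit Arguments. Unset Strict Implicit. Unset Printing Implicit Defensive.
Context {R : realType} {V : lmodType R}.
Implicit Types (D : set V) (p q : V -> R).

(** Subspaces are kept as sets: functionals are total on [V] and constrained only on [D], so no
    subtype with its own module structure is needed. *)
Definition submod_set D :=
  [/\ D 0, forall x y, D x -> D y -> D (x + y) &
      forall (c : R) x, D x -> D (c *: x)].

Definition sublinear_on D p :=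
  (forall x y, D x -> D y -> p (x + y) <= p x + p y) /\
  (forall (c : R) x, 0 <= c -> D x -> p (c *: x) = c * p x).

Lemma submodN D x : submod_set D -> D x -> D (- x).
Proof. by case=> _ _ DZ Dx; rewrite -scaleN1r; exact: DZ. Qed.

Lemma sublinear0 D p : submod_set D -> sublinear_on D p -> p 0 = 0.
Proof. by case=> D0 _ _ [_ /(_ 0 0)]; rewrite scale0r mul0r; exact. Qed.

Lemma sublinear_ge D p x : submod_set D -> sublinear_on D p -> D x ->
  - p (- x) <= p x.
Proof.
move=> sD sp Dx; have Dnx := submodN sD Dx.
have := sp.1 _ _ Dx Dnx; rewrite subrr (sublinear0 sD sp); lra.
Qed.

(** Inequalities suffice as assumptions: the missing half of homogeneity is the assumed half at
    [t^-1], and at [0] subadditivity gives [inf (S 0) <= 2 * inf (S 0)], that is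
    [0 <= inf (S 0)]. *)
Lemma inf_sublinear D (S : V -> set R) : submod_set D ->
  (forall x, D x -> has_inf (S x)) ->
  (exists2 a, S 0 a & a <= 0) ->
  (forall x y a b, D x -> D y -> S x a -> S y b ->
    exists2 c, S (x + y) c & c <= a + b) ->
  (forall t x a, 0 < t -> D x -> S x a -> exists2 b, S (t *: x) b & b <= t * a) ->
  sublinear_on D (fun x => inf (S x)).
Proof.
move=> [D0 DD DZ] hS [a0 S0 a0le] SD SZ.
have infle x a : D x -> S x a -> inf (S x) <= a.
  by move=> Dx Sa; exact: ge_inf (hS _ Dx).2 _ Sa.
have leinf x m : D x -> (forall a, S x a -> m <= a) -> m <= inf (S x).
  by move=> Dx h; apply: lb_le_inf => //; exact: (hS _ Dx).1.
have subD x y : D x -> D y -> inf (S (x + y)) <= inf (S x) + inf (S y).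
  move=> Dx Dy; rewrite -lerBlDr; apply: (leinf) => // a Sa.
  rewrite lerBlDr -lerBlDl; apply: (leinf) => // b Sb.
  have [c Sc cle] := SD _ _ _ _ Dx Dy Sa Sb.
  rewrite lerBlDl; apply: le_trans cle.
  by apply: (infle) => //; exact: DD.
have subZ t x : 0 < t -> D x -> inf (S (t *: x)) <= t * inf (S x).
  move=> t0 Dx; rewrite -ler_pdivrMl//; apply: (leinf) => // a Sa.
  have [b Sb ble] := SZ _ _ _ t0 Dx Sa.
  rewrite ler_pdivrMl//; apply: le_trans ble.
  by apply: (infle) => //; exact: DZ.
split=> // t x t0 Dx.
have [->|tn0] := eqVneq t 0.
  rewrite scale0r mul0r; apply/eqP; rewrite eq_le; apply/andP; split.
    exact: le_trans (infle _ _ D0 S0) a0le.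
  by have := subD _ _ D0 D0; rewrite addr0; lra.
have {t0 tn0}t0 : 0 < t by rewrite lt_neqAle eq_sym tn0.
apply/eqP; rewrite eq_le subZ//=.
have tV0 : 0 < t^-1 by rewrite invr_gt0.
have := subZ _ _ tV0 (DZ t _ Dx).
by rewrite scalerA mulVf ?gt_eqF// scale1r ler_pdivlMl.
Qed.

(** Zorn's lemma on the sublinear minorants of [q]. The bound of a nonempty chain is the pointwise
    infimum, which is finite because every minorant is at least [- q (- x)] at [x]. *)
Lemma minimal_sublinear D q : submod_set D -> sublinear_on D q ->
  exists p, [/\ sublinear_on D p, (forall x, D x -> p x <= q x) &
    forall p', sublinear_on D p' -> (forall x, D x -> p' x <= p x) ->
      forall x, D x -> p x <= p' x].
Proof.
move=> sD sq; have [D0 DD DZ] := sD.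
pose T := {p : V -> R | sublinear_on D p /\ forall x, D x -> p x <= q x}.
(* The order is reversed, so that a maximal element for [r] is a minimal functional. *)
pose r (p p' : T) := `[< forall x, D x -> sval p' x <= sval p x >].
have q0 : T by exists q.
have [||C Ctot|[p [sp pq]] pmin] := @ZL_preorder T q0 r.
- by move=> p; apply/asboolP.
- move=> p2 p1 p3 /asboolP h1 /asboolP h2; apply/asboolP => x Dx.
  exact: le_trans (h2 _ Dx) (h1 _ Dx).
- have [[c0 Cc0]|C0] := pselect (exists c, C c); last first.
    by exists q0 => c Cc; exfalso; apply: C0; exists c.
  pose S x := [set sval c x | c in C].
  have hS x : D x -> has_inf (S x).
    move=> Dx; split; first by exists (sval c0 x), c0.
    exists (- q (- x)) => _ [c _ <-].
    apply: le_trans (sublinear_ge sD (svalP c).1 Dx).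
    by rewrite lerN2; apply: (svalP c).2; exact: submodN.
  have infle x c : D x -> C c -> inf (S x) <= sval c x.
    by move=> Dx Cc; apply: (ge_inf (hS _ Dx).2); exists c.
  have sS : sublinear_on D (fun x => inf (S x)).
    apply: inf_sublinear => //.
    - exists (sval c0 0); first by exists c0.
      by rewrite (sublinear0 sD (svalP c0).1).
    (* Two members of the chain are comparable, and the smaller one serves at both [x] and [y]. *)
    - move=> x y _ _ Dx Dy [c Cc <-] [c' Cc' <-].
      have [/asboolP h|/asboolP h] := Ctot _ _ Cc Cc'.
        exists (sval c' (x + y)); first by exists c'.
        apply: le_trans ((svalP c').1.1 _ _ Dx Dy) _.
        by rewrite lerD2r; exact: h.
      exists (sval c (x + y)); first by exists c.
      apply: le_trans ((svalP c).1.1 _ _ Dx Dy) _.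
      by rewrite lerD2l; exact: h.
    - move=> t x _ t0 Dx [c Cc <-].
      exists (sval c (t *: x)); first by exists c.
      by rewrite (svalP c).1.2// ltW.
  have Sq x : D x -> inf (S x) <= q x.
    by move=> Dx; exact: le_trans (infle _ _ Dx Cc0) ((svalP c0).2 _ Dx).
  exists (exist _ (fun x => inf (S x)) (conj sS Sq)) => c Cc.
  by apply/asboolP => x Dx; exact: infle.
- exists p; split => // p' sp' p'p.
  have p'q x : D x -> p' x <= q x.
    by move=> Dx; exact: le_trans (p'p _ Dx) (pq _ Dx).
  have /= := pmin (exist _ p' (conj sp' p'q)).
  by move=> /(_ (asboolT p'p)) /asboolP.
Qed.

(* For fixed [y], [z |-> inf_(t >= 0) (p (z + t y) - t p y)] is a sublinear
   minorant of [p], hence equals [p] by minimality; [t = 1] gives additivity. *)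
Lemma minimal_sublinear_additive D p : submod_set D -> sublinear_on D p ->
  (forall p', sublinear_on D p' -> (forall x, D x -> p' x <= p x) ->
    forall x, D x -> p x <= p' x) ->
  forall x y, D x -> D y -> p (x + y) = p x + p y.
Proof.
move=> sD sp pmin x y Dx Dy; have [D0 DD DZ] := sD.
pose S z := [set p (z + t *: y) - t * p y | t in [set t : R | 0 <= t]].
have hS z : D z -> has_inf (S z).
  move=> Dz; split; first by exists (p (z + 0 *: y) - 0 * p y), 0 => /=.
  exists (- p (- z)) => _ [t /= t0 <-].
  have Dty : D (t *: y) by exact: DZ.
  have := sp.1 _ _ (DD _ _ Dz Dty) (submodN sD Dz).
  rewrite addrC addrA addNr add0r (sp.2 t y t0 Dy); lra.
have infle z t : D z -> 0 <= t -> inf (S z) <= p (z + t *: y) - t * p y.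
  by move=> Dz t0; apply: (ge_inf (hS _ Dz).2); exists t.
have sS : sublinear_on D (fun z => inf (S z)).
  apply: inf_sublinear => //.
  - exists (p (0 + 0 *: y) - 0 * p y); first by exists 0 => /=.
    by rewrite add0r scale0r (sublinear0 sD sp) mul0r subrr.
  - move=> u v _ _ Du Dv [s /= s0 <-] [t /= t0 <-].
    exists (p (u + v + (s + t) *: y) - (s + t) * p y).
      by exists (s + t) => //=; exact: addr_ge0.
    rewrite scalerDl addrACA.
    have := sp.1 _ _ (DD _ _ Du (DZ s _ Dy)) (DD _ _ Dv (DZ t _ Dy)); lra.
  - move=> t u _ t0 Du [s /= s0 <-].
    exists (p (t *: u + (t * s) *: y) - t * s * p y).
      by exists (t * s) => //=; rewrite mulr_ge0// ltW.
    rewrite -scalerA -scalerDr sp.2 ?(ltW t0)//; last by apply: DD => //; exact: DZ.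
    by rewrite mulrBr mulrA.
have le1 : forall z, D z -> p z <= inf (S z).
  apply: pmin => // z Dz; have := infle _ 0 Dz (lexx _).
  by rewrite scale0r addr0 mul0r subr0.
apply/eqP; rewrite eq_le sp.1//=.
have := le_trans (le1 _ Dx) (infle _ 1 Dx ler01).
rewrite scale1r mul1r; lra.
Qed.

(** A minimal sublinear functional is additive, hence odd, hence homogeneous for negative scalars
    too. No values on a subspace are prescribed: in the application they are forced by the choice of
    [q]. *)
Theorem hahn_banach_dominated D q : submod_set D -> sublinear_on D q ->
  exists phi : V -> R, [/\
    forall x y, D x -> D y -> phi (x + y) = phi x + phi y,
    forall c x, D x -> phi (c *: x) = c * phi x &
    forall x, D x -> phi x <= q x].
Proof.
move=> sD sq; have [p [sp pq pmin]] := minimal_sublinear sD sq.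
have pD := minimal_sublinear_additive sD sp pmin.
exists p; split=> // c x Dx.
have pN z : D z -> p (- z) = - p z.
  move=> Dz; have := pD _ _ Dz (submodN sD Dz).
  rewrite subrr (sublinear0 sD sp); lra.
have [c0|c0] := leP 0 c; first exact: sp.2.
have [_ _ DZ] := sD.
rewrite -[c in LHS]opprK scaleNr pN; last exact: DZ.
by rewrite sp.2// ?mulNr ?opprK// oppr_ge0 ltW.
Qed.
End HahnBanach.

(** * Bounded functions measurable for a sub-sigma-algebra *)

Section SigmaBounded.
Set Implicit Arguments. Unset Strict Implicit. Unset Printing Implicit Defensive.
Context {d : measure_display} {Omega : measurableType d} {R : realType}.
Variable P : probability Omega R.
Variable F : set (set Omega).
Hypothesis sF : sub_sigma F.
Implicit Types (X Y : Omega -> R) (S T : set Omega).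

(** [Omega] carrying [F] as its measurable sets, so that general facts on measurable functions and
    charges apply to [F]. *)
Let TF : measurableType F.-sigma := g_sigma_algebraType F.

Lemma sigma_measE : (measurable : set (set TF)) = F.
Proof. exact: measurable_g_measurableTypeE sF.1. Qed.

Lemma meas_wrtP X : meas_wrt F X <-> measurable_fun setT (X : TF -> R).
Proof.
split=> [mX _ S mS|mX S mS]; last by rewrite -sigma_measE -[X in _ X]setTI; exact: mX.
by rewrite setTI sigma_measE; exact: mX.
Qed.

Lemma sigma_setC S : F S -> F (~` S).
Proof. by rewrite -sigma_measE; exact: measurableC. Qed.

Lemma sigma_set0 : F set0.
Proof. by rewrite -sigma_measE; exact: measurable0. Qed.

Lemma sigma_setT : F setT.
Proof. by rewrite -sigma_measE; exact: measurableT. Qed.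

Lemma sigma_setI S T : F S -> F T -> F (S `&` T).
Proof. by rewrite -sigma_measE; exact: measurableI. Qed.

Lemma meas_wrt_sub (G : set (set Omega)) X : F `<=` G -> meas_wrt F X -> meas_wrt G X.
Proof. by move=> FG mX S mS; apply/FG/mX. Qed.

Lemma Linf_sub (G : set (set Omega)) X : F `<=` G -> Linf P F X -> Linf P G X.
Proof. by move=> FG [mX bX]; split=> //; exact: meas_wrt_sub FG mX. Qed.

Lemma meas_wrt_measurable X : meas_wrt F X -> measurable_fun setT X.
Proof. by move=> mX _ S mS; rewrite setTI; exact/sF.2/mX. Qed.

Lemma Linf_cst (c : R) : Linf P F (fun=> c).
Proof. by split; [apply/meas_wrtP; exact: measurable_cst|exists `|c|; exact/aeW]. Qed.

Lemma LinfD X Y : Linf P F X -> Linf P F Y -> Linf P F (X \+ Y).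
Proof.
move=> [/meas_wrtP mX [a aX]] [/meas_wrtP mY [b bY]]; split.
  by apply/meas_wrtP; exact: measurable_funD.
exists (a + b); apply: filterS2 aX bY => w aX bY.
exact: le_trans (ler_normD _ _) (lerD aX bY).
Qed.

Lemma LinfM X Y : Linf P F X -> Linf P F Y -> Linf P F (X \* Y).
Proof.
move=> [/meas_wrtP mX [a aX]] [/meas_wrtP mY [b bY]]; split.
  by apply/meas_wrtP; exact: measurable_funM.
exists (a * b); apply: filterS2 aX bY => w aX bY.
by rewrite normrM ler_pM.
Qed.

Lemma LinfZ (c : R) X : Linf P F X -> Linf P F (fun w => c * X w).
Proof. exact: LinfM (Linf_cst c). Qed.

Lemma LinfB X Y : Linf P F X -> Linf P F Y -> Linf P F (X \- Y).
Proof.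
move=> FX FY; have := LinfD FX (LinfZ (-1) FY).
by congr (Linf _ _ _); apply/funext => w /=; rewrite mulN1r.
Qed.

Lemma Linf_indic S : F S -> Linf P F (\1_S : Omega -> R).
Proof.
move=> FS; split; first by apply/meas_wrtP/measurable_indic; rewrite sigma_measE.
exists 1; apply: aeW => w; rewrite indicE.
by case: (_ \in _); rewrite ?normr1// normr0.
Qed.

Lemma Linf_indicM S X : F S -> Linf P F X -> Linf P F (fun w => \1_S w * X w).
Proof. by move=> FS; exact/LinfM/Linf_indic. Qed.

Lemma Linf_norm X : Linf P F X -> Linf P F (fun w => `|X w|).
Proof.
move=> [/meas_wrtP mX [a aX]]; split.
  by apply/meas_wrtP; exact: (measurableT_comp (@normr_measurable R setT) mX).
by exists a; apply: filterS aX => w; rewrite normr_id.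
Qed.

Lemma Linfp_norm X : Linf P F X -> Linfp P F (fun w => `|X w|).
Proof. by move=> FX; split; [exact: Linf_norm|exact: aeW]. Qed.

Lemma Linfp_cst (c : R) : 0 <= c -> Linfp P F (fun=> c).
Proof. by move=> c0; split; [exact: Linf_cst|exact: aeW]. Qed.

Lemma LinfpD X Y : Linfp P F X -> Linfp P F Y -> Linfp P F (X \+ Y).
Proof.
move=> [FX X0] [FY Y0]; split; first exact: LinfD.
by apply: filterS2 X0 Y0 => w; exact: addr_ge0.
Qed.

Lemma LinfpM X Y : Linfp P F X -> Linfp P F Y -> Linfp P F (X \* Y).
Proof.
move=> [FX X0] [FY Y0]; split; first exact: LinfM.
by apply: filterS2 X0 Y0 => w; exact: mulr_ge0.
Qed.

Lemma LinfpZ (c : R) X : 0 <= c -> Linfp P F X -> Linfp P F (fun w => c * X w).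
Proof. by move=> c0; exact: LinfpM (Linfp_cst c0). Qed.

Lemma Linfp_indicM S X : F S -> Linfp P F X -> Linfp P F (fun w => \1_S w * X w).
Proof. by move=> FS; apply: LinfpM; split; [exact: Linf_indic|exact: aeW]. Qed.

(** * Integrals of bounded functions and comparison through integrals *)

Lemma Linf_integrable X : Linf P F X -> P.-integrable setT (EFin \o X).
Proof.
move=> [/meas_wrt_measurable mX [c cX]].
apply/integrableP; split; first exact/measurable_EFinP.
apply: (@le_lt_trans _ _ (\int[P]_w (`|c|)%:E)%E); last first.
  by rewrite integral_cst// [X in (_ * X)%E]probability_setT mule1 ltry.
apply: ae_ge0_le_integral => //.
- by apply/measurableT_comp => //; exact/measurable_EFinP.
- by apply: filterS cX => w cX _ /=; rewrite lee_fin (le_trans cX)// ler_norm.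
Qed.

Lemma Linf_RintegralD X Y : Linf P F X -> Linf P F Y ->
  \int[P]_w (X w + Y w) = \int[P]_w X w + \int[P]_w Y w.
Proof. by move=> FX FY; rewrite RintegralD//; exact: Linf_integrable. Qed.

Lemma Linf_RintegralZ (c : R) X : Linf P F X ->
  \int[P]_w (c * X w) = c * \int[P]_w X w.
Proof. by move=> FX; rewrite RintegralZl//; exact: Linf_integrable. Qed.

Lemma Linf_Rintegral_le X Y : Linf P F X -> Linf P F Y -> aele P X Y ->
  \int[P]_w X w <= \int[P]_w Y w.
Proof.
move=> FX FY XY; rewrite -subr_ge0.
have FD := LinfB FY FX.
rewrite -RintegralB//; [|exact: Linf_integrable..].
have iD := Linf_integrable FD.
(* The difference is a.e. equal to its absolute value, whose integral is nonnegative. *)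
rewrite /Rintegral (@ae_eq_integral _ _ _ _ _ (fun w => (`|Y w - X w|)%:E)) //.
- by apply: fine_ge0; apply: integral_ge0.
- exact: measurable_int iD.
- exact: measurable_int (Linf_integrable (Linf_norm FD)).
- by apply: filterS XY => w XY _; rewrite ger0_norm// subr_ge0.
Qed.

(* Assumes integrability only, since it serves to show that a Radon-Nikodym density is bounded. *)
Lemma aele_Rintegral X Y : meas_wrt F X -> meas_wrt F Y ->
  P.-integrable setT (EFin \o X) -> P.-integrable setT (EFin \o Y) ->
  (forall S, F S -> \int[P]_(w in S) X w <= \int[P]_(w in S) Y w) ->
  aele P X Y.
Proof.
move=> mX mY iX iY XY.
(* Testing the assumption on the set where the conclusion fails: there [X - Y] is positive with
   integral at most [0], so this set is null. *)
pose S := [set w | 0 < X w - Y w].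
have FS : F S.
  have /meas_wrtP mD : measurable_fun setT (fun w : TF => X w - Y w).
    by apply: measurable_funB; exact/meas_wrtP.
  have /mD : measurable (`]0, +oo[%classic : set R) by exact: measurable_itv.
  by congr F; apply/seteqP; split=> w; rewrite /= in_itv /= andbT.
have mS := sF.2 _ FS.
have iD : P.-integrable S (EFin \o (fun w => X w - Y w)).
  have : P.-integrable S ((EFin \o X) \- (EFin \o Y))%E.
    by apply: integrableB => //; exact: (@integrableS _ _ _ _ setT).
  exact.
have : (\int[P]_(w in S) `|(X w - Y w)%:E|)%E = 0%E.
  apply/eqP; rewrite eq_le integral_ge0 ?andbT//.
  under eq_integral => w /set_mem Sw do rewrite gee0_abs ?lee_fin ?ltW//.
  rewrite -[leLHS]fineK; last exact: integrable_fin_num.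
  rewrite lee_fin -/(Rintegral P S (fun w => X w - Y w)) RintegralB//;
    [|exact: (@integrableS _ _ _ _ setT)..].
  by rewrite subr_le0; exact: XY.
have mD := measurable_int _ iD.
move/(ae_eq_integral_abs P mS mD) => D0.
apply: filterS D0 => w /= D0; rewrite leNgt; apply/negP => YX.
have Sw : S w by rewrite /S /= subr_gt0.
by case: (D0 Sw) => /eqP; rewrite gt_eqF.
Qed.

Lemma Rintegral_indicM S X : \int[P]_(w in S) X w = \int[P]_w (\1_S w * X w).
Proof.
by rewrite Rintegral_mkcond patch_indic; apply: eq_Rintegral => w _ /=; rewrite mulrC.
Qed.

Lemma Linf_aele X Y : Linf P F X -> Linf P F Y ->
  (forall S, F S ->
    \int[P]_w (\1_S w * X w) <= \int[P]_w (\1_S w * Y w)) ->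
  aele P X Y.
Proof.
move=> FX FY XY; apply: aele_Rintegral; first exact: FX.1; first exact: FY.1.
- exact: Linf_integrable.
- exact: Linf_integrable.
by move=> S FS; rewrite (Rintegral_indicM S X) (Rintegral_indicM S Y); exact: XY.
Qed.

(** Turns remainders of a series into values on tail unions. It is stated for an arbitrary additive
    [m] because it is applied both to the charge and to [P]. *)
Lemma additive_tail (m : set Omega -> R) (S : nat -> set Omega) n :
  (forall S T, F S -> F T -> S `&` T = set0 -> m (S `|` T) = m S + m T) ->
  (forall i, F (S i)) -> trivIset setT S ->
  F (\bigcup_(i in [set i | (n <= i)%N]) S i) /\
  m (\bigcup_(i in [set i | (n <= i)%N]) S i) =
    m (\bigcup_i S i) - \sum_(0 <= i < n) m (S i).
Proof.
move=> mD FS tS.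
have FT k : F (\bigcup_(i in [set i | (k <= i)%N]) S i).
  rewrite -sigma_measE; apply: bigcup_measurable => i _.
  by rewrite sigma_measE.
split=> //; elim: n => [|n IH].
  by rewrite big_geq// subr0; congr (m _); apply: eq_bigcupl; split.
rewrite big_nat_recr//= opprD addrA -IH.
have -> : \bigcup_(i in [set i | (n <= i)%N]) S i =
    S n `|` \bigcup_(i in [set i | (n < i)%N]) S i.
  apply/seteqP; split => [w [i /= ni Siw]|w [Snw|[i /= ni Siw]]].
  - move: ni; rewrite leq_eqVlt => /predU1P[->|ni]; first by left.
    by right; exists i.
  - by exists n => /=.
  - by exists i => //=; exact: ltnW.
rewrite mD//; first by rewrite addrAC subrr add0r.
apply/seteqP; split=> // w [Snw [i /= ni Siw]].
have := tS n i I I; rewrite /= => /(_ (ex_intro _ w (conj Snw Siw))) nE.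
by rewrite nE ltnn in ni.
Qed.

(** The bound by [c] times [P] does three things: it makes a finitely additive [m] countably
    additive, it makes [m] absolutely continuous, and it bounds the density by [c]. *)
Lemma Radon_Nikodym_Linf (m : set Omega -> R) (c : R) :
  (forall S T, F S -> F T -> S `&` T = set0 -> m (S `|` T) = m S + m T) ->
  (forall S, F S -> `|m S| <= c * fine (P S)) ->
  exists X, Linf P F X /\ forall S, F S -> m S = \int[P]_w (\1_S w * X w).
Proof.
move=> mD mc.
have F0 := sigma_set0.
have m0 : m set0 = 0.
  have := mD set0 set0 F0 F0 (setI0 _); rewrite setU0; lra.
pose nu (S : set TF) : \bar R := (m S)%:E.
have nu0 : nu set0 = 0%E by rewrite /nu m0.
have nufin (S : set TF) : measurable S -> nu S \is a fin_num by [].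
have nusa : semi_sigma_additive nu.
  move=> S mS tS mU.
  have FS i : F (S i) by rewrite -sigma_measE.
  have Psum : \sum_(0 <= i < n) fine (P (S i)) @[n --> \oo] --> fine (P (\bigcup_i S i)).
    have PU : ((\sum_(0 <= i < n) P (S i))%E @[n --> \oo] -->
        (fine (P (\bigcup_i S i)))%:E).
      rewrite sigma_measE in mU; rewrite fineK; last exact/fin_num_measure/sF.2.
      by apply: measure_semi_sigma_additive => //; [move=> i|]; exact: sF.2.
    have [_] := (fine_cvgP _ _).1 PU.
    apply: cvg_trans; apply: near_eq_cvg; apply: nearW => n /=.
    by rewrite sum_fine// => i _; apply: fin_num_measure; exact: sF.2.
  (* The remainder of the series of [m (S i)] is [m] of a tail union, hence at most [c] times the
     remainder of the convergent series of [P (S i)]. *)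
  have Fm := (fun n => additive_tail n mD FS tS).
  have PD S' T' : F S' -> F T' -> S' `&` T' = set0 ->
      fine (P (S' `|` T')) = fine (P S') + fine (P T').
    move=> FS' FT' ST0; rewrite measureU//; [|exact: sF.2..].
    by rewrite fineD// fin_num_measure//; exact: sF.2.
  have Fp := (fun n => additive_tail (m := fun S => fine (P S)) n PD FS tS).
  rewrite /nu; under eq_fun do rewrite sumEFin.
  apply: cvg_EFin; first exact: nearW.
  apply/cvgrPdist_le => e e0.
  (* Dividing by [|c| + 1] avoids any case distinction on [c], in particular [c = 0]. *)
  have c1 : 0 < `|c| + 1 by apply: ltr_wpDl.
  move/cvgrPdist_le : Psum => /(_ (e / (`|c| + 1))) /(_ (divr_gt0 e0 c1)).
  apply: filterS => n /= pn.
  rewrite -(Fm n).2; apply: le_trans (mc _ (Fm n).1) _; rewrite (Fp n).2.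
  apply: (@le_trans _ _ ((`|c| + 1) * (e / (`|c| + 1)))); last first.
    by rewrite mulrCA divff ?mulr1// gt_eqF.
  apply: (le_trans (ler_norm _)); rewrite normrM.
  by apply: ler_pM => //; rewrite lerDl.
have mid : measurable_fun setT (id : Omega -> TF).
  by move=> _ S; rewrite sigma_measE setTI => FS; exact: sF.2.
(* The restriction of [P] to [F] is obtained as the image of [P] under the identity, which is
   measurable from [Omega] to [TF]. *)
pose idm : {mfun Omega >-> TF} :=
  HB.pack (id : Omega -> TF) (isMeasurableFun.Build _ _ Omega TF _ mid).
pose mu := distribution P idm.
pose nuc : {charge set TF -> \bar R} := HB.pack nu (isCharge.Build _ TF R nu nu0 nufin nusa).
have nudom : nuc `<< mu.
  apply/null_content_dominatesP => S; rewrite sigma_measE => FS PS0.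
  rewrite /= /nu; congr (_%:E); apply/eqP; rewrite -normr_le0.
  apply: le_trans (mc _ FS) _.
  have -> : P S = 0%E by exact: PS0.
  by rewrite mulr0.
pose f := Radon_Nikodym nuc mu.
have ffin w : f w \is a fin_num by exact: Radon_Nikodym_fin_num.
have fint : mu.-integrable setT f by exact: Radon_Nikodym_integrable.
have mf : measurable_fun setT f by exact: measurable_int fint.
pose X (w : Omega) := fine (f w).
have XE : EFin \o X = f \o idm by apply/funext => w; rewrite /= fineK.
have mX : meas_wrt F X.
  by apply/meas_wrtP; exact: (measurableT_comp (fine_measurable measurableT) mf).
have iX : P.-integrable setT (EFin \o X).
  apply/integrableP; split; first exact/measurable_EFinP/meas_wrt_measurable.
  move/integrableP : fint => [_]; rewrite ge0_integral_distribution//.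
    by apply: le_lt_trans; rewrite XE.
  exact: measurableT_comp.
have mE S : F S -> m S = \int[P]_(w in S) X w.
  move=> FS.
  have mS : measurable (S : set TF) by rewrite sigma_measE.
  have iXS : P.-integrable (idm @^-1` S) (f \o idm).
    by rewrite -XE; apply: integrableS iX => //; exact: sF.2.
  have := Radon_Nikodym_integral nudom mS.
  rewrite /= /mu /distribution (integral_pushforward mid mf iXS mS) => mE.
  by rewrite /Rintegral -/(EFin \o X) XE -[m S]/(fine (nu S)) mE.
(* On each [S] in [F] the integral of [X] is [m S], which lies between those of [- c] and [c]. *)
have Xb : aele P (fun=> - c) X /\ aele P X (fun=> c).
  split; apply: aele_Rintegral => //; try exact: (Linf_cst _).1;
    try exact: Linf_integrable (Linf_cst _).
    move=> S FS; rewrite -mE// Rintegral_cst; last exact: sF.2.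
    by have := mc _ FS; rewrite mulNr ler_norml => /andP[].
  move=> S FS; rewrite -mE// Rintegral_cst; last exact: sF.2.
  by have := mc _ FS; rewrite ler_norml => /andP[].
exists X; split; last by move=> S FS; rewrite -Rintegral_indicM; exact: mE.
split=> //; exists c; apply: filterS2 Xb.1 Xb.2 => w.
by rewrite ler_norml => -> ->.
Qed.

End SigmaBounded.

(** * The dominated scalar functional *)

Section Majorant.
Set Implicit Arguments. Unset Strict Implicit. Unset Printing Implicit Defensive.
Context {d : measure_display} {Omega : measurableType d} {R : realType}.
Variables (P : probability Omega R) (A B : set (set Omega)).
Variables (L : set (Omega -> R)) (x M : (Omega -> R) -> (Omega -> R)).
Hypotheses (sA : sub_sigma A) (sB : sub_sigma B) (AB : A `<=` B).
Hypotheses (sL : linear_subspace P B L) (lx : mono_linear_on P A L x).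
Hypotheses (opM : op_pos P A B M) (wM : weak_homogeneous P A B M).
Hypothesis subM : sublinear P B M.
Hypothesis xM : forall X Y, L X -> Linfp P B Y -> aele P X Y -> aele P (x X) (M Y).
Implicit Types (X Y W : Omega -> R) (S : set Omega).

Lemma M_cst0 : aeeq P (M (fun=> 0)) (fun=> 0).
Proof.
have := subM.2 0 (fun=> 0) (lexx _) (Linfp_cst P sB (lexx _)).
have -> : (fun w : Omega => 0 * 0) = (fun=> 0 : R) by apply/funext => w; rewrite mul0r.
by apply: filterS => w ->; rewrite mul0r.
Qed.

Lemma x_cst0 : aeeq P (x (fun=> 0)) (fun=> 0).
Proof.
have := lx.2.2.1 0 (fun=> 0) sL.2.1.
have -> : (fun w : Omega => 0 * 0) = (fun=> 0 : R) by apply/funext => w; rewrite mul0r.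
by apply: filterS => w ->; rewrite mul0r.
Qed.

(* On each piece [{k = n}] of a countable [A]-partition, [X] is dominated by [Y
   n + Z n]; since the sought extension is local, [W] must then dominate its
   value at [X]. Allowing partitions makes the infimum of [E W] subadditive and
   compatible with multiplication by [\1_S], [S] in [A]. *)
Definition majorant X W :=
  Linf P A W /\ exists (k : Omega -> nat) (Y Z : nat -> Omega -> R),
    [/\ forall n, A (k @^-1` [set n]),
        forall n, Linfp P B (Y n), forall n, L (Z n),
        {ae P, forall w, X w <= Y (k w) w + Z (k w) w} &
        {ae P, forall w, M (Y (k w)) w + x (Z (k w)) w <= W w}].

Lemma ae_forall_nat2 (Q : nat -> nat -> Omega -> Prop) :
  (forall i j, {ae P, forall w, Q i j w}) -> {ae P, forall w, forall i j, Q i j w}.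
Proof. by move=> h; apply: ae_foralln => i; exact: ae_foralln. Qed.

(** The common refinement of the two partitions works, its pieces being indexed by codes of
    pairs. *)
Lemma majorantD X X' W W' :
  majorant X W -> majorant X' W' -> majorant (X \+ X') (W \+ W').
Proof.
move=> [AW [k [Y [Z [Ak BY LZ XYZ YZW]]]]] [AW' [k' [Y' [Z' [Ak' BY' LZ' XYZ' YZW']]]]].
split; first exact: LinfD.
(* The default [(0, 0)] is harmless: a number that is not the code of a pair labels an empty
   piece. *)
pose ij n : nat * nat := odflt (0, 0)%N (unpickle n).
have ijK u : ij (pickle u) = u by rewrite /ij pickleK.
exists (fun w => pickle (k w, k' w)), (fun n => Y (ij n).1 \+ Y' (ij n).2),
  (fun n => Z (ij n).1 \+ Z' (ij n).2); split.
- move=> n; have [nE|nE] := eqVneq (pickle (ij n)) n.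
    rewrite (_ : _ @^-1` _ = k @^-1` [set (ij n).1] `&` k' @^-1` [set (ij n).2]).
      exact: sigma_setI.
    apply/seteqP; split=> w /=; first by move=> <-; rewrite ijK.
    by case=> -> ->; rewrite -surjective_pairing.
  rewrite (_ : _ @^-1` _ = set0); first exact: sigma_set0.
  by apply/seteqP; split=> w //= kn; move: nE; rewrite -kn ijK eqxx.
- by move=> n; apply: LinfpD.
- by move=> n; apply: sL.2.2.1.
- by apply: filterS2 XYZ XYZ' => w; rewrite ijK /=; lra.
(* One null set must serve all pairs of indices, since the indices used at [w] depend on [w]. *)
- have MD : {ae P, forall w, forall i j, M (Y i \+ Y' j) w <= M (Y i) w + M (Y' j) w}.
    by apply: ae_forall_nat2 => i j; exact: subM.1.
  have xD : {ae P, forall w, forall i j, x (Z i \+ Z' j) w = x (Z i) w + x (Z' j) w}.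
    by apply: ae_forall_nat2 => i j; exact: lx.2.1.
  apply: filterS2 (filterI MD xD) (filterI YZW YZW') => w [MDw xDw] [h h'].
  by rewrite ijK /= xDw; have := MDw (k w) (k' w); lra.
Qed.

Lemma majorantZ (t : R) X W : 0 <= t ->
  majorant X W -> majorant (fun w => t * X w) (fun w => t * W w).
Proof.
move=> t0 [AW [k [Y [Z [Ak BY LZ XYZ YZW]]]]].
split; first exact: LinfZ.
exists k, (fun n w => t * Y n w), (fun n w => t * Z n w); split=> //.
- by move=> n; exact: LinfpZ.
- by move=> n; apply: sL.2.2.2.1.
- by apply: filterS XYZ => w h; rewrite -mulrDr ler_wpM2l.
- have MZ : {ae P, forall w, forall i, M (fun w => t * Y i w) w = t * M (Y i) w}.
    by apply: ae_foralln => i; exact: subM.2.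
  have xZ : {ae P, forall w, forall i, x (fun w => t * Z i w) w = t * x (Z i) w}.
    by apply: ae_foralln => i; exact: lx.2.2.1.
  apply: filterS2 (filterI MZ xZ) YZW => w [MZw xZw] h.
  by rewrite MZw xZw -mulrDr ler_wpM2l.
Qed.

(** One piece and [Z = 0]. This yields the domination of the functional by the integral of [M Y]. *)
Lemma majorant_M X Y : Linfp P B Y -> aele P X Y -> majorant X (M Y).
Proof.
move=> BY XY; split; first exact: (opM.1 _ BY).1.
exists (fun=> 0%N), (fun=> Y), (fun=> fun=> 0); split=> //.
- move=> n; case: n => [|n].
    rewrite (_ : _ @^-1` _ = setT); first exact: sigma_setT.
    by apply/seteqP; split.
  rewrite (_ : _ @^-1` _ = set0); last by apply/seteqP; split.
  exact: sigma_set0.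
- by move=> n; exact: sL.2.1.
- by apply: filterS XY => w; rewrite addr0.
- by apply: filterS x_cst0 => w ->; rewrite addr0.
Qed.

(** Two pieces, with [Z = X] on [S] (label 1), [Z = 0] off [S] (label 0), and [Y = 0]. The partition
    is what handles [1_S X], which need not belong to [L]. *)
Lemma majorant_x S X : A S -> L X ->
  majorant (fun w => \1_S w * X w) (fun w => \1_S w * x X w).
Proof.
move=> AS LX; split; first by apply: Linf_indicM => //; exact: lx.1.
exists (fun w => (w \in S) : nat), (fun=> fun=> 0),
  (fun n => if n is 0%N then fun=> 0 else X); split=> //.
- case=> [|[|n]].
  + rewrite (_ : _ @^-1` _ = ~` S); first exact: sigma_setC.
    apply/seteqP; split=> w /=; last by move=> nSw; rewrite memNset.
    by move=> h /mem_set wS; rewrite wS in h.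
  + rewrite (_ : _ @^-1` _ = S)//.
    apply/seteqP; split=> w /=; last by move=> Sw; rewrite mem_set.
    by have [wS _|] := boolP (w \in S); first exact: set_mem.
  + rewrite (_ : _ @^-1` _ = set0); last by apply/seteqP; split=> w //=; case: (w \in S).
    exact: sigma_set0.
- by move=> n; exact: Linfp_cst.
- by case=> [|n] //; exact: sL.2.1.
- by apply: aeW => w; rewrite indicE add0r; case: (w \in S); rewrite ?mul1r ?mul0r.
- apply: filterS2 M_cst0 x_cst0 => w M0 x0.
  by rewrite indicE M0 add0r; case: (w \in S); rewrite ?mul1r ?mul0r ?x0.
Qed.

(* By weak homogeneity, [M Y] on [S] only depends on [Y] restricted to [S], so
   [Y] may be replaced by [`|X|] off [S]. *)
Lemma local_domination S X Y : A S -> L X -> Linfp P B Y ->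
  {ae P, forall w, S w -> X w <= Y w} ->
  {ae P, forall w, S w -> x X w <= M Y w}.
Proof.
move=> AS LX BY XY; have BS := AB AS.
pose Z w := \1_S w * Y w + \1_(~` S) w * `|X w|.
have BZ : Linfp P B Z.
  apply: LinfpD => //; apply: Linfp_indicM => //; first exact: sigma_setC.
  by apply: Linfp_norm => //; exact: sL.1.
have XZ : aele P X Z.
  apply: filterS XY => w h; rewrite /Z !indicE in_setC.
  case: (boolP (w \in S)) => wS /=; last by rewrite mul0r mul1r add0r ler_norm.
  by rewrite mul1r mul0r addr0; apply/h/set_mem.
have SZ : (fun w => \1_S w * Z w) = (fun w => \1_S w * Y w).
  apply/funext => w; rewrite /Z !indicE in_setC.
  by case: (w \in S) => /=; rewrite ?mul0r// addr0 !mul1r.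
have h1 := wM AS BZ; have h2 := wM AS BY; rewrite SZ in h1.
apply: filterS2 (filterI h1 h2) (xM LX BZ XZ) => w [e1 e2] h Sw.
by move: e1; rewrite e2 !indicE mem_set// !mul1r => ->.
Qed.

(** On the piece [k = n] one has [- Z n <= Y n + c], so local domination and sublinearity give
    [- x (Z n) <= M (Y n) + M c], while [W >= M (Y n) + x (Z n)]. *)
Lemma majorant_ge X W (c : R) : 0 <= c -> majorant X W ->
  {ae P, forall w, - c <= X w} -> aele P (fun w => - M (fun=> c) w) W.
Proof.
move=> c0 [AW [k [Y [Z [Ak BY LZ XYZ YZW]]]]] cX.
have Bc := Linfp_cst P sB c0.
have LNZ n : L (fun w => -1 * Z n w) by exact: sL.2.2.2.1.
have h1 : {ae P, forall w, forall n, k w = n ->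
    x (fun w => -1 * Z n w) w <= M (Y n \+ (fun=> c)) w}.
  apply: ae_foralln => n; apply: (local_domination (Ak n)) => //.
    by apply: LinfpD.
  by apply: filterS2 XYZ cX => w + + kn; rewrite kn /=; lra.
have h2 : {ae P, forall w, forall n, x (fun w => -1 * Z n w) w = -1 * x (Z n) w}.
  by apply: ae_foralln => n; exact: lx.2.2.1.
have h3 : {ae P, forall w, forall n,
    M (Y n \+ (fun=> c)) w <= M (Y n) w + M (fun=> c) w}.
  by apply: ae_foralln => n; exact: subM.1.
apply: filterS2 (filterI h1 h2) (filterI h3 YZW) => w [a1 a2] [a3 a4].
have := a1 _ erefl; rewrite a2; have := a3 (k w); lra.
Qed.

Lemma Linf_bound X : Linf P B X -> exists2 c : R, 0 <= c & {ae P, forall w, `|X w| <= c}.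
Proof.
move=> [_ [c cX]]; exists `|c| => //.
by apply: filterS cX => w h; exact: le_trans h (ler_norm _).
Qed.

(** With [R^o] as codomain the functions form a module over [R], as the Hahn-Banach theorem
    requires. *)
Let V := (Omega -> R^o).

Lemma Linf_submod : submod_set (Linf P B : set V).
Proof.
split; first exact: (Linf_cst P sB 0).
- by move=> X Y; exact: LinfD.
- by move=> c X; exact: LinfZ.
Qed.

Theorem dominated_functional : exists phi : (Omega -> R) -> R, [/\
  forall X Y, Linf P B X -> Linf P B Y -> phi (X \+ Y) = phi X + phi Y,
  forall c X, Linf P B X -> phi (fun w => c * X w) = c * phi X,
  forall X Y, Linf P B X -> Linfp P B Y -> aele P X Y ->
    phi X <= \int[P]_w M Y w &
  forall S X, A S -> L X ->
    phi (fun w => \1_S w * X w) = \int[P]_w (\1_S w * x X w)].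
Proof.
pose U (X : V) : set R := [set \int[P]_w W w | W in majorant X].
have hU X : Linf P B X -> has_inf (U X).
  move=> BX; split.
    exists (\int[P]_w M (fun w => `|X w|) w), (M (fun w => `|X w|)) => //.
    apply: majorant_M; first exact: Linfp_norm.
    by apply: aeW => w; exact: ler_norm.
  have [c c0 cX] := Linf_bound BX.
  have BMc : Linf P A (fun w => - M (fun=> c) w).
    have := LinfZ sA (-1) (opM.1 _ (Linfp_cst P sB c0)).1.
    by congr (Linf _ _ _); apply/funext => w; rewrite mulN1r.
  exists (\int[P]_w (- M (fun=> c) w)) => _ [W maj <-].
  apply: (Linf_Rintegral_le sA) => //; first exact: maj.1.
  apply: majorant_ge maj _ => //.
  by apply: filterS cX => w; rewrite ler_norml => /andP[].
have infle X W : Linf P B X -> majorant X W -> inf (U X) <= \int[P]_w W w.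
  by move=> BX maj; apply: (ge_inf (hU _ BX).2); exists W.
have sU : sublinear_on (Linf P B : set V) (fun X => inf (U X)).
  apply: inf_sublinear => //; first exact: Linf_submod.
  - exists (\int[P]_w M (fun=> 0) w).
      by exists (M (fun=> 0)) => //; apply: majorant_M; [exact: Linfp_cst|exact: aeW].
    have [AM0 _] := opM.1 _ (Linfp_cst P sB (lexx 0)).
    have I0 : \int[P]_w (0 : R) = 0 by rewrite Rintegral_cst// mul0r.
    rewrite -[leRHS]I0.
    apply: (Linf_Rintegral_le sA) => //; first exact: (Linf_cst P sA 0).
    by apply: filterS M_cst0 => w ->.
  - move=> X Y _ _ BX BY [W maj <-] [W' maj' <-].
    exists (\int[P]_w (W w + W' w)); first by exists (W \+ W') => //; exact: majorantD.
    by rewrite (Linf_RintegralD sA) ?maj.1 ?maj'.1//; [exact: maj.1|exact: maj'.1].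
  - move=> t X _ t0 BX [W maj <-].
    exists (\int[P]_w (t * W w)).
      by exists (fun w => t * W w) => //; apply: majorantZ => //; exact: ltW.
    by rewrite (Linf_RintegralZ sA)//; exact: maj.1.
have [phi [phiD phiZ phiU]] := hahn_banach_dominated Linf_submod sU.
have phile X W : Linf P B X -> majorant X W -> phi X <= \int[P]_w W w.
  by move=> BX maj; exact: le_trans (phiU _ BX) (infle _ _ BX maj).
have phix S X : A S -> L X ->
    phi (fun w => \1_S w * X w) <= \int[P]_w (\1_S w * x X w).
  move=> AS LX; apply: phile; last exact: majorant_x.
  by apply: Linf_indicM => //; [exact: AB|exact: sL.1].
exists phi; split=> //.
  by move=> X Y BX BY XY; apply: phile => //; exact: majorant_M.
(* The reverse inequality is [phix] applied to [- X], which is again in [L]. *)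
move=> S X AS LX; apply/eqP; rewrite eq_le phix//=.
have BX : Linf P B (fun w => \1_S w * X w).
  by apply: Linf_indicM => //; [exact: AB|exact: sL.1].
have LNX : L (fun w => -1 * X w) by exact: sL.2.2.2.1.
have := phix _ _ AS LNX.
have -> : (fun w => \1_S w * (-1 * X w)) = (fun w => -1 * (\1_S w * X w)).
  by apply/funext => w; rewrite mulrCA.
rewrite (phiZ (-1) _ BX).
have Ax : Linf P A (fun w => \1_S w * x X w) by apply: Linf_indicM => //; exact: lx.1.
have AxN : Linf P A (fun w => \1_S w * x (fun w => -1 * X w) w).
  by apply: Linf_indicM => //; exact: lx.1.
have : \int[P]_w (\1_S w * x (fun w => -1 * X w) w) <= \int[P]_w (-1 * (\1_S w * x X w)).
  apply: (Linf_Rintegral_le sA) => //; first exact: LinfZ.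
  by apply: filterS (lx.2.2.1 (-1) _ LX) => w ->; rewrite mulrCA.
rewrite (Linf_RintegralZ sA)//; lra.
Qed.

End Majorant.

(** * The extension as a Radon-Nikodym density *)

Section AlmostEverywhere.
Set Implicit Arguments. Unset Strict Implicit. Unset Printing Implicit Defensive.
Context {d : measure_display} {Omega : measurableType d} {R : realType}.
Variable P : probability Omega R.
Implicit Types X Y : Omega -> R.

Lemma aeeq_le X Y : aeeq P X Y -> aele P X Y.
Proof. by apply: filterS => w ->. Qed.

Lemma aele_anti X Y : aele P X Y -> aele P Y X -> aeeq P X Y.
Proof. by move=> XY YX; apply: filterS2 XY YX => w h h'; apply/eqP; rewrite eq_le h. Qed.

Lemma ae_forall_rat (Q : rat -> Omega -> Prop) :
  (forall q, {ae P, forall w, Q q w}) -> {ae P, forall w, forall q, Q q w}.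
Proof.
move=> h.
have : {ae P, forall w, forall n q, unpickle n = Some q -> Q q w}.
  apply: ae_foralln => n; case: (unpickle n) => [q|]; last exact: aeW.
  by apply: filterS (h q) => w Qw _ [<-].
by apply: filterS => w Qw q; exact: Qw (pickleK q).
Qed.

Lemma decr_to_ge (Xn : nat -> Omega -> R) X :
  decr_to P Xn X -> {ae P, forall w, forall n, X w <= Xn n w}.
Proof.
move=> [dX cX]; have := ae_foralln dX.
apply: filterS2 cX => w cw dw n.
have /nonincreasing_cvgn_ge : nonincreasing_seq (fun n => Xn n w).
  by apply/nonincreasing_seqP.
move=> /(_ (cvgP _ cw)) /(_ n) /=.
by rewrite (cvg_lim _ cw).
Qed.

End AlmostEverywhere.

(** * Existence, algebraic properties and continuity of the density *)

Section Extension.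
Set Implicit Arguments. Unset Strict Implicit. Unset Printing Implicit Defensive.
Context {d : measure_display} {Omega : measurableType d} {R : realType}.
Variables (P : probability Omega R) (A B : set (set Omega)).
Variables (M x' : (Omega -> R) -> (Omega -> R)).
Variable phi : (Omega -> R) -> R.
Hypotheses (sA : sub_sigma A) (sB : sub_sigma B) (AB : A `<=` B).
Hypotheses (opM : op_pos P A B M) (wM : weak_homogeneous P A B M).
Hypotheses (rM : regular P B M) (subM : sublinear P B M).
Hypothesis phiD : forall X Y, Linf P B X -> Linf P B Y -> phi (X \+ Y) = phi X + phi Y.
Hypothesis phiZ : forall c X, Linf P B X -> phi (fun w => c * X w) = c * phi X.
Hypothesis phiM : forall X Y, Linf P B X -> Linfp P B Y -> aele P X Y ->
  phi X <= \int[P]_w M Y w.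
Implicit Types (X Y : Omega -> R) (S T : set Omega).

Lemma functional_density X : Linf P B X -> exists Z, Linf P A Z /\
  forall S, A S -> phi (fun w => \1_S w * X w) = \int[P]_w (\1_S w * Z w).
Proof.
move=> BX; have [c c0 cX] := Linf_bound BX.
have Bc := Linfp_cst P sB c0; have AMc := (opM.1 _ Bc).1.
have [_ [C MC]] := AMc.
(* From [1_S Y <= 1_S c], weak homogeneity bounds [phi (1_S Y)] by the integral of [1_S M(c)], and
   [C] bounds [M(c)]. Taking [X] and [- X] for [Y] gives both sides of the estimate. *)
have phile S Y : A S -> Linf P B Y -> {ae P, forall w, Y w <= c} ->
    phi (fun w => \1_S w * Y w) <= C * fine (P S).
  move=> AS BY Yc; have BS := AB AS.
  apply: (@le_trans _ _ (\int[P]_w M (fun w => \1_S w * c) w)).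
    apply: phiM; first exact: Linf_indicM.
      exact: (Linfp_indicM sB BS Bc).
    by apply: filterS Yc => w h; rewrite ler_wpM2l.
  rewrite -Rintegral_cst; last exact: sB.2.
  rewrite [leRHS]Rintegral_indicM.
  apply: (Linf_Rintegral_le sA).
  - exact: (opM.1 _ (Linfp_indicM sB BS Bc)).1.
  - by apply: Linf_indicM => //; exact: Linf_cst.
  - apply: filterS2 (wM AS Bc) MC => w -> h.
    by rewrite ler_wpM2l// (le_trans (ler_norm _)).
apply: (Radon_Nikodym_Linf sA (c := C)).
- move=> S T AS AT ST0.
  rewrite -phiD; [|by apply: Linf_indicM => //; exact: AB..].
  congr phi; apply/funext => w /=; rewrite -mulrDl !indicE in_setU; congr (_ * _).
  have [wS|] := boolP (w \in S); have [wT|] := boolP (w \in T); rewrite ?addr0 ?add0r//.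
  by have : (S `&` T) w by [split; exact: set_mem]; rewrite ST0.
- move=> S AS; rewrite ler_norml; apply/andP; split; last first.
    by apply: phile => //; apply: filterS cX => w; rewrite ler_norml => /andP[].
  have BSX : Linf P B (fun w => \1_S w * X w) by apply: Linf_indicM => //; exact: AB.
  rewrite lerNl -mulN1r -phiZ//.
  have -> : (fun w => -1 * (\1_S w * X w)) = (fun w => \1_S w * (-1 * X w)).
    by apply/funext => w; rewrite mulrCA.
  apply: phile => //; first exact: LinfZ.
  by apply: filterS cX => w; rewrite mulN1r lerNl ler_norml => /andP[].
Qed.

Hypothesis Ax' : forall X, Linf P B X -> Linf P A (x' X).
Hypothesis phix' : forall X S, Linf P B X -> A S ->
  phi (fun w => \1_S w * X w) = \int[P]_w (\1_S w * x' X w).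

(** Integrals over the sets of [A] determine an element of [L_infty(A)]. Additivity, scalar
    homogeneity, compatibility with indicators and agreement with [x] on [L] are all derived this
    way. *)
Lemma density_unique X Z : Linf P B X -> Linf P A Z ->
  (forall S, A S -> phi (fun w => \1_S w * X w) = \int[P]_w (\1_S w * Z w)) ->
  aeeq P (x' X) Z.
Proof.
move=> BX AZ h; have Ax := Ax' BX.
by apply: aele_anti; apply: (Linf_aele sA) => // S AS; rewrite -phix'// h.
Qed.

Lemma densityD X Y : Linf P B X -> Linf P B Y -> aeeq P (x' (X \+ Y)) (x' X \+ x' Y).
Proof.
move=> BX BY; apply: density_unique => [||S AS]; first exact: LinfD.
  by apply: LinfD => //; exact: Ax'.
have BS := AB AS.
under eq_Rintegral do rewrite mulrDr.
rewrite (Linf_RintegralD sA); [|by apply: Linf_indicM => //; exact: Ax'..].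
rewrite -!phix'// -phiD; [|exact: Linf_indicM..].
by congr phi; apply/funext => w /=; rewrite mulrDr.
Qed.

Lemma densityZ (c : R) X : Linf P B X -> aeeq P (x' (fun w => c * X w)) (fun w => c * x' X w).
Proof.
move=> BX; apply: density_unique => [||S AS]; first exact: LinfZ.
  by apply: LinfZ => //; exact: Ax'.
have BS := AB AS.
under eq_Rintegral do rewrite mulrCA.
rewrite (Linf_RintegralZ sA); last by apply: Linf_indicM => //; exact: Ax'.
rewrite -phix'// -phiZ; last exact: Linf_indicM.
by congr phi; apply/funext => w /=; rewrite mulrCA.
Qed.

Lemma densityB X Y : Linf P B X -> Linf P B Y -> aeeq P (x' X) (x' (X \- Y) \+ x' Y).
Proof.
move=> BX BY; have := densityD (LinfB sB BX BY) BY.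
have -> //: (X \- Y) \+ Y = X.
by apply/funext => w /=; rewrite subrK.
Qed.

Lemma density_indicM S X : A S -> Linf P B X ->
  aeeq P (x' (fun w => \1_S w * X w)) (fun w => \1_S w * x' X w).
Proof.
move=> AS BX; have BS := AB AS.
apply: density_unique => [||T AT]; first exact: Linf_indicM.
  by apply: Linf_indicM => //; exact: Ax'.
have IE (Y : Omega -> R) : (fun w => \1_T w * (\1_S w * Y w)) = (fun w => \1_(T `&` S) w * Y w).
  by apply/funext => w; rewrite indicI mulrA.
have := phix' BX (sigma_setI sA AT AS).
by rewrite -IE => ->; apply: eq_Rintegral => w _;
  rewrite -[RHS]/((fun w => \1_T w * (\1_S w * x' X w)) w) IE.
Qed.

(** Weak homogeneity localizes the scalar bound: [phi (1_S X)] is at most the integral of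
    [M (1_S Y)], that is of [1_S M Y], for every [S] in [A]. *)
Lemma density_leM X Y : Linf P B X -> Linfp P B Y -> aele P X Y -> aele P (x' X) (M Y).
Proof.
move=> BX BY XY; have AMY := (opM.1 _ BY).1.
apply: (Linf_aele sA) => //; first exact: Ax'.
move=> S AS; have BS := AB AS.
have BSY := Linfp_indicM sB BS BY.
rewrite -phix'//; apply: le_trans (_ : \int[P]_w M (fun w => \1_S w * Y w) w <= _).
  apply: phiM => //; first exact: Linf_indicM.
  by apply: filterS XY => w h; rewrite ler_wpM2l.
apply: (Linf_Rintegral_le sA); first exact: (opM.1 _ BSY).1.
  exact: Linf_indicM.
by apply: aeeq_le; exact: wM.
Qed.

(** Domination with [Y = 0] suffices: [X - Y <= 0] gives [x' (X - Y) <= M 0 = 0]. *)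
Lemma density_mono X Y : Linf P B X -> Linf P B Y -> aele P X Y -> aele P (x' X) (x' Y).
Proof.
move=> BX BY XY.
have XY0 : aele P (X \- Y) (fun=> 0) by apply: filterS XY => w; rewrite subr_le0.
have h := density_leM (LinfB sB BX BY) (Linfp_cst P sB (lexx 0)) XY0.
apply: filterS2 (filterI h (M_cst0 sB subM)) (densityB BX BY) => w [a M0] ->.
by rewrite -[leRHS]add0r lerD2r -M0.
Qed.

Lemma density_decr (Xn : nat -> Omega -> R) X :
  (forall n, Linf P B (Xn n)) -> Linf P B X -> decr_to P Xn X ->
  decr_to P (fun n => x' (Xn n)) (x' X).
Proof.
move=> BXn BX dX; split; first by move=> n; exact/density_mono/dX.1.
have XXn := decr_to_ge dX.
pose Y n := Xn n \- X.
have BY n : Linf P B (Y n) by exact: LinfB.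
have BYp n : Linfp P B (Y n).
  by split=> //; apply: filterS XXn => w /(_ n); rewrite subr_ge0.
have dY : decr_to P Y (fun=> 0).
  split; first by move=> n; apply: filterS (dX.1 n) => w; rewrite lerD2r.
  by apply: filterS dX.2 => w /subr_cvg0.
have hB : {ae P, forall w, forall n, x' (Xn n) w = x' (Y n) w + x' X w}.
  by apply: ae_foralln => n; exact: densityB.
have hM : {ae P, forall w, forall n, x' (Y n) w <= M (Y n) w}.
  by apply: ae_foralln => n; apply: density_leM => //; exact: aeW.
have h0 : {ae P, forall w, forall n, x' X w <= x' (Xn n) w}.
  apply: ae_foralln => n; apply: density_mono => //.
  by apply: filterS XXn => w /(_ n).
apply: filterS2 (filterI hB hM) (filterI h0 (rM BYp dY)) => w [eB leM] [ge0 cM].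
apply/subr_cvg0; apply: (squeeze_cvgr _ (cvg_cst 0) cM).
apply: nearW => n; apply/andP; split; first by rewrite subr_ge0.
by rewrite eB addrK.
Qed.

(* Only indicators and scalars are available so far: for rational [r], compare
   [lam X] with [r X] on [{lam <= r}]. *)
Lemma density_homo_le (lam X : Omega -> R) : Linf P A lam -> Linfp P B X ->
  aele P (x' (lam \* X)) (lam \* x' X).
Proof.
move=> Alam BXp; have [BX X0] := BXp.
have Blam := Linf_sub AB Alam.
have BlX : Linf P B (lam \* X) by exact: LinfM.
have hr (r : R) : {ae P, forall w, lam w <= r -> x' (lam \* X) w <= r * x' X w}.
  pose S := [set w | lam w <= r].
  have AS : A S.
    have -> : S = lam @^-1` `]-oo, r] by apply/seteqP; split=> w; rewrite /= in_itv.
    by apply: Alam.1; exact: measurable_itv.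
  have BS := AB AS.
  have BSX : Linf P B (fun w => \1_S w * X w) by exact: Linf_indicM.
  have le1 : aele P (fun w => \1_S w * (lam \* X) w) (fun w => r * (\1_S w * X w)).
    apply: filterS X0 => w X0; rewrite /= indicE.
    case: (boolP (w \in S)) => [/set_mem Sw|_]; last by rewrite !mul0r mulr0.
    by rewrite !mul1r ler_wpM2r.
  have := density_mono (Linf_indicM sB BS BlX) (LinfZ sB r BSX) le1.
  move=> h1; have h2 := density_indicM AS BlX; have h3 := density_indicM AS BX.
  apply: filterS2 (filterI h1 h2) (filterI h3 (densityZ r BSX)) => w [+ e2] [e3 e4] Sw.
  by rewrite e2 e4 e3 !indicE mem_set// !mul1r.
have hq : {ae P, forall w, forall q : rat, lam w <= ratr q ->
    x' (lam \* X) w <= ratr q * x' X w}.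
  by apply: ae_forall_rat => q.
have x'0 : aele P (fun=> 0) (x' X).
  have B0 := Linf_cst P sB 0.
  apply: filterS2 (densityZ 0 B0) (density_mono B0 BX X0) => w.
  have -> : (fun w : Omega => 0 * 0) = (fun=> 0 : R) by apply/funext => ?; rewrite mul0r.
  by move=> ->; rewrite mul0r.
apply: filterS2 hq x'0 => w hw x0; apply/ler_addgt0Pr => e e0.
(* The added [1] covers [x' X w = 0]; a rational [q] within [e / (x' X w + 1)] above [lam w] costs
   at most [e]. *)
have b0 : 0 < x' X w + 1 by apply: ltr_wpDl.
have : lam w < lam w + e / (x' X w + 1) by rewrite ltrDl divr_gt0.
move=> /rat_in_itvoo[q]; rewrite in_itv /= => /andP[lq qe].
apply: le_trans (hw q (ltW lq)) _.
apply: le_trans (ler_wpM2r x0 (ltW qe)) _.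
rewrite mulrDl lerD2l -mulrA ler_piMr ?(ltW e0)//.
by rewrite mulrC ler_pdivrMr// mul1r lerDl.
Qed.

(** For [X >= 0] the reverse inequality is [density_homo_le] at [- lam], which is available because
    that lemma puts no sign on [lam]. A general [X] is shifted by a constant [c] to become
    nonnegative, and the contribution of [c] is subtracted. *)
Lemma density_homo (lam X : Omega -> R) : Linf P A lam -> Linf P B X ->
  aeeq P (x' (lam \* X)) (lam \* x' X).
Proof.
have pos Y l : Linf P A l -> Linfp P B Y -> aeeq P (x' (l \* Y)) (l \* x' Y).
  move=> Al BY; apply: aele_anti; first exact: density_homo_le.
  have BlY : Linf P B (l \* Y) by apply: LinfM => //; [exact: Linf_sub AB Al|exact: BY.1].
  have := density_homo_le (LinfZ sA (-1) Al) BY.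
  apply: filterS2 (densityZ (-1) BlY) => w.
  have -> : (fun w => -1 * (l \* Y) w) = ((fun w => -1 * l w) \* Y).
    by apply/funext => ? /=; rewrite mulrA.
  by move=> -> /=; rewrite !mulN1r mulNr lerN2.
move=> Alam BX; have Blam := Linf_sub AB Alam.
have [c c0 cX] := Linf_bound BX.
have Bc := Linfp_cst P sB c0.
have BXc : Linfp P B (X \+ (fun=> c)).
  split; first by apply: LinfD => //; exact: Bc.1.
  by apply: filterS cX => w; rewrite ler_norml => /andP[h _] /=; rewrite -lerBlDr sub0r.
have BlX : Linf P B (lam \* X) by exact: LinfM.
have Blc : Linf P B (lam \* (fun=> c)) by apply: LinfM => //; exact: Bc.1.
have h1 := densityD BlX Blc.
have h2 := densityD BX Bc.1.
have E : (lam \* X) \+ (lam \* (fun=> c)) = lam \* (X \+ (fun=> c)).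
  by apply/funext => w /=; rewrite mulrDr.
rewrite E in h1.
apply: filterS2 (filterI h1 h2) (filterI (pos _ _ Alam BXc) (pos _ _ Alam Bc)) => w.
by move=> [/= e1 e2] [e3 e4]; move: e1; rewrite e3 e4 e2 mulrDr => /addIr.
Qed.

End Extension.

Theorem theorem3p10 (d : measure_display) (Omega : measurableType d)
  (R : realType) (P : probability Omega R)
  (A B : set (set Omega)) (L : set (Omega -> R))
  (x M : (Omega -> R) -> (Omega -> R)) :
  measure_is_complete P ->
  sub_sigma A -> sub_sigma B -> A `<=` B ->
  ctbl_gen_mod_null P B ->
  linear_subspace P B L ->
  mono_linear_on P A L x ->
  op_pos P A B M -> regular P B M -> weak_homogeneous P A B M ->
  sublinear P B M ->
  (forall X Y, L X -> Linfp P B Y -> aele P X Y -> aele P (x X) (M Y)) ->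
  exists x' : (Omega -> R) -> (Omega -> R),
    [/\ mono_linear_on P A (Linf P B) x',
        (forall X, L X -> aeeq P (x' X) (x X)),
        (forall X Y, Linf P B X -> Linfp P B Y -> aele P X Y ->
            aele P (x' X) (M Y)),
        (forall (Xn : nat -> Omega -> R) (X : Omega -> R),
            (forall n, Linf P B (Xn n)) -> Linf P B X -> decr_to P Xn X ->
            decr_to P (fun n => x' (Xn n)) (x' X)) &
        (forall lam X, Linfp P A lam -> Linf P B X ->
            aeeq P (x' (lam \* X)) (lam \* x' X))].
Proof.
move=> _ sA sB AB _ sL lx opM rM wM subM xM.
have [phi [phiD phiZ phiM phix]] := dominated_functional sA sB AB sL lx opM wM subM xM.
have : forall X, exists Z, Linf P B X -> Linf P A Z /\
    forall S, A S -> phi (fun w => \1_S w * X w) = \int[P]_w (\1_S w * Z w).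
  (* Outside [L_infty(B)] the value is arbitrary; [X] itself is taken. *)
  move=> X; have [BX|nBX] := pselect (Linf P B X); last by exists X.
  by have [Z ?] := functional_density sA sB AB opM wM phiD phiZ phiM BX; exists Z.
move=> /choice[x' hx'].
have Ax' X : Linf P B X -> Linf P A (x' X) by move=> /hx'[].
have phix' X S : Linf P B X -> A S ->
    phi (fun w => \1_S w * X w) = \int[P]_w (\1_S w * x' X w).
  by move=> /hx'[_ h] /h.
exists x'; split.
- split=> //; split; [|split].
  + exact: (densityD sA sB AB phiD Ax' phix').
  + exact: (densityZ sA sB AB phiZ Ax' phix').
  + exact: (density_mono sA sB AB opM wM subM phiD phiM Ax' phix').
- move=> X LX.
  (* On [L], the function [x X] already has the integrals that characterize the density. *)
  apply: (density_unique sA Ax' phix' (sL.1 _ LX) (lx.1 _ LX)) => S AS.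
  exact: phix.
- exact: (density_leM sA sB AB opM wM phiM Ax' phix').
- exact: (density_decr sA sB AB opM wM rM subM phiD phiM Ax' phix').
- move=> lam X [Alam _].
  exact: (density_homo sA sB AB opM wM subM phiD phiZ phiM Ax' phix' Alam).
Qed.
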